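(* Let $\alpha\in(0,1)$. There exist constants $D\in(0,1)$ and $K>0$, depending only on $\alpha$, such that for every integer $n>2$, every real $p\ge1$ and every $\delta\in(0,D)$ there exist an input-output linkage matrix $W$ of $n$ firms and an observed input-output linkage matrix $U$ of the same $n$ firms, obtained from $W$ with missing data such that for each firm $i$ the missing data accounts for at most a $\delta$ share of the total intermediate input use of firm $i$, with $$\|v_W-v_U\|_p\ge K\delta .$$ (That is, $\|v_W-v_U\|_p=\Omega(\delta)$, with constants depending on $\alpha$.)
   Context: An input-output linkage matrix of $n$ firms is a real $n\times n$ matrix $W=(w_{ij})$ with $w_{ij}\ge 0$, $w_{ii}=0$ and $\sum_{j=1}^n w_{ij}=1$ for all $i$; $w_{ij}$ is the share of the intermediate inputs of firm $i$ that come from firm $j$. With $W'$ the transpose of $W$ and $\vec{\mathbf 1}$ the all-ones column vector, the influence vector of $W$ (for the parameter $\alpha\in(0,1)$) is $v_W=\frac{\alpha}{n}(I-(1-\alpha)W')^{-1}\vec{\mathbf 1}$ (the inverse exists). Missing data: firm $i$ has total intermediate input use $\mathrm{II}_i>0$, of which $w_{ij}\mathrm{II}_i$ comes from firm $j$. Only amounts $x_{ij}$ with $0\le x_{ij}\le w_{ij}\mathrm{II}_i$ are observed; the rest is missing. ''The missing data accounts for at most a $\delta$ share of the total intermediate input use of firm $i$'' means $\sum_j x_{ij}\ge(1-\delta)\mathrm{II}_i$. The observed matrix is $U=(u_{ij})$ with $u_{ij}=x_{ij}/\sum_k x_{ik}$. $\|v\|_p=(\sum_i|v_i|^p)^{1/p}$.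 *)

(* Defs.v *)
From HB Require Import structures.
From mathcomp Require Import all_boot all_order all_algebra.
From mathcomp Require Import all_classical all_reals all_analysis.

Set Implicit Arguments.
Unset Strict Implicit.
Unset Printing Implicit Defensive.

Import Order.TTheory GRing.Theory Num.Theory.
Local Open Scope ring_scope.

Section Linkage.
Context {R : realType} {n : nat}.
Implicit Types (W U : 'M[R]_n) (alpha delta p : R) (v : 'cV[R]_n).

Definition linkage_matrix W : Prop :=
  [/\ forall i j, 0 <= W i j,
      forall i, W i i = 0 &
      forall i, \sum_j W i j = 1].

(* [invmx A] is [A] itself when [A] is singular; this never happens for a
   linkage matrix [W] and [0 < alpha < 1], since [I - (1 - alpha) W] is
   strictly diagonally dominant by rows. *)
Definition influence alpha W : 'cV[R]_n :=
  (alpha / n%:R) *: (invmx (1%:M - (1 - alpha) *: W^T) *m const_mx 1).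

(* [II i] is the total intermediate input use of firm [i], and [x i j] the
   observed part of the amount [W i j * II i] that firm [i] buys from [j]. *)
Definition observed_with_missing delta W U : Prop :=
  exists (II : 'I_n -> R) (x : 'M[R]_n),
    [/\ forall i, 0 < II i,
        forall i j, 0 <= x i j <= W i j * II i,
        forall i, (1 - delta) * II i <= \sum_j x i j &
        forall i j, U i j = x i j / \sum_k x i k].

Definition pnorm p v : R := (\sum_i `|v i 0| `^ p) `^ p^-1.

End Linkage.

(* Main.v *)
(** Every firm of [U] buys from firm 0, except firm 0, which buys from firm 1.
    In [W] the firms other than 0 and 1 move a share delta of their inputs from
    firm 0 to firm 1. Firms 2, ..., n-1 sell nothing, so each of them has
    influence alpha / n in both networks, and with c = alpha (n - 2) / n the
    influences of firms 0 and 1 change by opposite amounts, of absolute value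
    (1 - alpha) delta c / (2 - alpha). As n >= 3 gives c >= alpha / 3, a single
    coordinate already yields the bound for every p. *)
Require Import Defs.
From mathcomp Require Import all_boot all_order all_algebra.
From mathcomp Require Import all_classical all_reals all_analysis.
From mathcomp Require Import ring lra.

Set Implicit Arguments.
Unset Strict Implicit.
Unset Printing Implicit Defensive.

Import Order.TTheory GRing.Theory Num.Theory.
Local Open Scope ring_scope.

Section Influence.
Variables (R : realType) (n : nat).
Implicit Types (W U V : 'M[R]_n) (alpha delta p : R) (v : 'cV[R]_n).

Lemma ler_coord_pnorm p v i : 0 < p -> `|v i 0| <= pnorm p v.
Proof.
move=> p0; rewrite /pnorm.
have {1}-> : `|v i 0| = (`|v i 0| `^ p) `^ p^-1.
  by rewrite -powRrM mulfV ?gt_eqF// powRr1.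
apply: ge0_ler_powR; rewrite ?nnegrE ?invr_ge0 ?powR_ge0 ?(ltW p0)//.
  by apply: sumr_ge0 => j _; exact: powR_ge0.
by rewrite (bigD1 i)//= lerDl; apply: sumr_ge0 => j _; exact: powR_ge0.
Qed.

(* A row vector [v = (1 - alpha) v W] has l^1 norm at most [1 - alpha] times
   itself, as [W] has row sums 1. *)
Lemma influence_mx_unit alpha W : 0 < alpha < 1 -> linkage_matrix W ->
  1%:M - (1 - alpha) *: W^T \in unitmx.
Proof.
move=> /andP[a0 a1] [W0 _ W1]; rewrite unitmxE unitfE -det_tr.
apply/det0P => -[v vN0 /eqP].
rewrite linearB/= linearZ/= trmxK trmx1 mulmxBr mulmx1 subr_eq0.
rewrite -scalemxAr => /eqP vE.
have norm_le : \sum_j `|v 0 j| <= (1 - alpha) * \sum_j `|v 0 j|.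
  have {2}-> : \sum_j `|v 0 j| = \sum_j \sum_i `|v 0 i| * W i j.
    rewrite exchange_big; apply: eq_bigr => i _ /=.
    by rewrite -mulr_sumr W1 mulr1.
  rewrite mulr_sumr; apply: ler_sum => j _.
  rewrite {1}vE !mxE normrM ger0_norm ?subr_ge0 ?(ltW a1)//.
  rewrite ler_wpM2l ?subr_ge0 ?(ltW a1)//; apply: le_trans (ler_norm_sum _ _ _) _.
  by apply: ler_sum => i _; rewrite normrM (ger0_norm (W0 _ _)).
have sum0 : \sum_j `|v 0 j| = 0.
  have S0 : 0 <= \sum_j `|v 0 j| by apply: sumr_ge0.
  by nra.
move/eqP: vN0; apply; apply/rowP => j; rewrite mxE; apply/eqP.
rewrite -normr_eq0; move/eqP: sum0; rewrite psumr_eq0// => /allP/(_ j).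
by rewrite mem_index_enum => /(_ isT).
Qed.

(** Multiplying the definition by [1%:M - (1 - alpha) *: W^T] removes the inverse, so influences can
    be found from linear equations alone. *)
Lemma influence_fixpoint alpha W j : 0 < alpha < 1 -> linkage_matrix W ->
  influence alpha W j 0 =
  alpha / n%:R + (1 - alpha) * \sum_i W i j * influence alpha W i 0.
Proof.
move=> ha hW; have uA := influence_mx_unit ha hW.
have : (1%:M - (1 - alpha) *: W^T) *m influence alpha W =
       (alpha / n%:R) *: const_mx 1.
  by rewrite /influence -scalemxAr mulKVmx.
move: (influence alpha W) => v.
rewrite mulmxBl mul1mx -scalemxAl => /matrixP/(_ j 0).
rewrite !mxE mulr1 => <-.
under eq_bigr do rewrite mxE.
by rewrite subrK.
Qed.

Definition buy_from_mx (f : 'I_n -> 'I_n) : 'M[R]_n :=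
  \matrix_(i, j) (j == f i)%:R.

Lemma linkage_buy_from_mx f :
  (forall i, f i != i) -> linkage_matrix (buy_from_mx f).
Proof.
move=> fN; split=> [i j|i|i]; rewrite ?mxE ?ler0n//.
  by rewrite eq_sym (negbTE (fN i)).
under eq_bigr do rewrite mxE.
by rewrite (bigD1 (f i))//= eqxx big1 ?addr0// => j /negbTE ->.
Qed.

Lemma linkage_conv delta U V : 0 <= delta <= 1 ->
  linkage_matrix U -> linkage_matrix V ->
  linkage_matrix ((1 - delta) *: U + delta *: V).
Proof.
move=> /andP[d0 d1] [U0 Ud U1] [V0 Vd V1]; split=> [i j|i|i].
- by rewrite !mxE addr_ge0// mulr_ge0// subr_ge0.
- by rewrite !mxE Ud Vd !mulr0 addr0.
- under eq_bigr do rewrite !mxE.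
  by rewrite big_split/= -!mulr_sumr U1 V1 !mulr1 subrK.
Qed.

(** Give every firm total input 1 and hide the [V] part. What is seen is [(1 - delta) *: U], whose
    rows all sum to [1 - delta], so normalizing returns [U]. *)
Lemma observed_conv delta U V : 0 <= delta < 1 ->
  linkage_matrix U -> linkage_matrix V ->
  observed_with_missing delta ((1 - delta) *: U + delta *: V) U.
Proof.
move=> /andP[d0 d1] [U0 _ U1] [V0 _ _].
exists (fun=> 1), ((1 - delta) *: U).
have d1' : 0 < 1 - delta by rewrite subr_gt0.
have sumE i : \sum_j ((1 - delta) *: U) i j = 1 - delta.
  by under eq_bigr do rewrite mxE; rewrite -mulr_sumr U1 mulr1.
split=> [//|i j|i|i j].
- by rewrite !mxE mulr1 mulr_ge0 ?(ltW d1')//= lerDl mulr_ge0.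
- by rewrite sumE mulr1.
- by rewrite sumE mxE mulrAC mulfV ?mul1r// gt_eqF.
Qed.

End Influence.

Section Network.
Variables (R : realType) (m : nat).
Local Notation n := m.+3.
Local Notation i0 := (ord0 : 'I_n).
Local Notation i1 := (lift ord0 ord0 : 'I_n).
Local Notation others j := (lift ord0 (lift ord0 j) : 'I_n).

(** The hub [h] needs a supplier [k] of its own because the diagonal must vanish. *)
Definition hub_mx (h k : 'I_n) : 'M[R]_n :=
  buy_from_mx R (fun i => if i == h then k else h).

Lemma linkage_hub_mx h k : h != k -> linkage_matrix (hub_mx h k).
Proof.
move=> hk; apply: linkage_buy_from_mx => i.
by case: (eqVneq i h) => [->|]; rewrite eq_sym.
Qed.

(** The two hub networks agree on the rows of [i0] and [i1], so [delta] affects only the other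
    firms. *)
Definition full_mx (delta : R) : 'M[R]_n :=
  (1 - delta) *: hub_mx i0 i1 + delta *: hub_mx i1 i0.

Lemma full_mx0 : full_mx 0 = hub_mx i0 i1.
Proof. by rewrite /full_mx subr0 scale1r scale0r addr0. Qed.

Lemma linkage_full_mx delta : 0 <= delta <= 1 -> linkage_matrix (full_mx delta).
Proof. by move=> hd; apply: linkage_conv => //; exact: linkage_hub_mx. Qed.

(** Here [c] is the joint influence of the firms that sell nothing, which [i0] and [i1] share in
    proportions [1 - delta] and [delta]. Allowing [delta = 0] covers the observed network too. *)
Lemma influence_full_mx (alpha delta : R) : 0 < alpha < 1 -> 0 <= delta <= 1 ->
  let c := m.+1%:R * (alpha / n%:R) in
  let v (i : 'I_n) : R := influence alpha (full_mx delta) i 0 in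
  v i0 = alpha / n%:R + (1 - alpha) * (v i1 + (1 - delta) * c) /\
  v i1 = alpha / n%:R + (1 - alpha) * (v i0 + delta * c).
Proof.
move=> ha hd c v.
have vE j := influence_fixpoint j ha (linkage_full_mx hd).
have vo j : v (others j) = alpha / n%:R.
  rewrite /v vE big1 ?mulr0 ?addr0// => i _.
  by rewrite !mxE; case: ifP => _; case: ifP => _; rewrite /= !mulr0 addr0 mul0r.
have sumc (a : R) : \sum_(j < m.+1) a * v (others j) = a * c.
  under eq_bigr do rewrite vo.
  by rewrite sumr_const card_ord -[LHS]mulr_natl mulrCA.
have sumE j : \sum_i full_mx delta i j * influence alpha (full_mx delta) i 0 =
    full_mx delta i0 j * v i0 + (full_mx delta i1 j * v i1 +
      \sum_(i < m.+1) full_mx delta (others i) j * v (others i)).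
  by rewrite 2!big_ord_recl.
split; rewrite {1}/v vE sumE; congr (_ + _ * _).
- rewrite (eq_bigr (fun i => (1 - delta) * v (others i))) ?sumc => [|i _].
    by rewrite !mxE /=; ring.
  by rewrite !mxE /=; ring.
- rewrite (eq_bigr (fun i => delta * v (others i))) ?sumc => [|i _].
    by rewrite !mxE /=; ring.
  by rewrite !mxE /=; ring.
Qed.

End Network.

Lemma hub_system_diff (F : realFieldType) (a b c d w0 w1 u0 u1 : F) :
    0 < a < 1 ->
    w0 = b + (1 - a) * (w1 + (1 - d) * c) /\ w1 = b + (1 - a) * (w0 + d * c) ->
    u0 = b + (1 - a) * (u1 + (1 - 0) * c) /\ u1 = b + (1 - a) * (u0 + 0 * c) ->
  u0 - w0 = (1 - a) * c / (2 - a) * d.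
Proof.
move=> /andP[a0 a1] [W0 W1] [U0 U1].
have a2 : 2 - a != 0 by lra.
(* Adding the two equations of a system eliminates [d]: the total [s] satisfies
   [a * s = 2 * b + (1 - a) * c] in both. *)
have opposite : u1 - w1 = - (u0 - w0).
  apply/eqP; rewrite -addr_eq0; apply/eqP/(mulfI (lt0r_neq0 a0)).
  by rewrite mulr0; lra.
have diffE : u0 - w0 = (1 - a) * (u1 - w1 + d * c) by lra.
apply: (mulIf a2); rewrite [RHS]mulrAC divfK//.
by move: diffE; rewrite opposite; lra.
Qed.

Theorem theorem3p2 (R : realType) (alpha : R) (halpha : 0 < alpha < 1) :
  exists D K : R, [/\ 0 < D < 1, 0 < K &
    forall (n : nat) (p delta : R), (2 < n)%N -> 1 <= p -> 0 < delta < D ->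
      exists W U : 'M[R]_n,
        [/\ linkage_matrix W, linkage_matrix U,
            observed_with_missing delta W U &
            K * delta <= pnorm p (influence alpha W - influence alpha U)]].
Proof.
have /andP[a0 a1] := halpha.
(* [D] only has to keep [delta] below 1. [K] is the coefficient of [delta] in [hub_system_diff] with
   [c] replaced by its lower bound [alpha / 3]. *)
exists (1 / 2), ((1 - alpha) * (alpha / 3) / (2 - alpha)); split; first by lra.
  by rewrite divr_gt0 ?mulr_gt0 ?subr_gt0 ?invr_gt0//; lra.
case=> [|[|[|m]]] // p delta _ p1 /andP[d0 d1].
have hd : 0 <= delta <= 1 by lra.
have hd0 : 0 <= (0 : R) <= 1 by rewrite lexx ler01.
exists (full_mx m delta), (full_mx m 0); split=> //; try exact: linkage_full_mx.
- rewrite full_mx0; apply: observed_conv; first by lra.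
    exact: linkage_hub_mx.
  exact: linkage_hub_mx.
apply: le_trans (ler_coord_pnorm _ ord0 (lt_le_trans ltr01 p1)).
have diffE := hub_system_diff halpha (influence_full_mx m halpha hd)
  (influence_full_mx m halpha hd0).
(* Firm 0 is more influential in [U] than in [W], so the difference is flipped before the absolute
   value is dropped. *)
rewrite mxE [X in `|_ + X|]mxE -normrN opprB; apply: le_trans (ler_norm _).
rewrite diffE ler_wpM2r ?(ltW d0)// ler_wpM2r ?invr_ge0; first by lra.
  by lra.
(* What remains is [1 / 3 <= (m + 1) / (m + 3)], with equality at [m = 0], that is, for three
   firms. *)
rewrite ler_wpM2l ?subr_ge0 ?(ltW a1)// mulrCA ler_pM2l//.
rewrite ler_pdivlMr ?ltr0n// -[m.+3]addn3 -[m.+1]addn1 !natrD.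
by have := ler0n R m; lra.
Qed.
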